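(* Let $k\ge1$ and let $v_1,\dots,v_n\in\mathbb{R}^d$ be an arbitrary (fixed) sequence of $n$ vectors containing at least $k+1$ distinct vectors. Let $W^*$ be the optimal $k$-means cost of this multiset, let $\gamma=\dfrac{\max_{v,v'}\|v-v'\|}{\min_{v\ne v'}\|v-v'\|}$ (max and min over pairs of distinct vectors in the sequence), and run the fully online $k$-means algorithm (described in the context) on the sequence; let $C$ be its final set of centers and $w^*$ the value it computes. Then $$\mathbb{E}[|C|]=O\!\left(k\log n\,\log\frac{W^*}{w^*}\right)=O\!\left(k\log n\,\log(\gamma n)\right),$$ where the expectation is over the algorithm's internal randomness and the constants in $O(\cdot)$ are absolute.
   Context: Norms are Euclidean, and $\log$ denotes the base-2 logarithm. The optimal $k$-means cost of vectors $v_1,\dots,v_n$ is $W^*=\min\sum_{i=1}^k\sum_{v\in S_i}\|v-c_i\|_2^2$, the minimum taken over all partitions of the vectors into $k$ sets $S_1,\dots,S_k$ and all choices of centers $c_1,\dots,c_k\in\mathbb{R}^d$. For a point $v$ and a finite set $C$, $D(v,C)=\min_{c\in C}\|v-c\|$. Fully online $k$-means algorithm (input: the stream and $k$; the length of the stream is not known to it): let $C$ be the set of the first $k+1$ distinct vectors of the stream, each of which is output as its own center, and set a counter $m\gets k+1$. Set $w^*\gets\min_{v\ne v'\in C}\|v-v'\|^2/2$, $r\gets1$, $q_1\gets0$, $f_1\gets w^*/k$. For each remaining vector $v$ of the stream, in order: set $m\gets m+1$; with probability $p=\min(D^2(v,C)/f_r,1)$ (independently of all other random choices), set $C\gets C\cup\{v\}$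 and $q_r\gets q_r+1$; then, if $q_r\ge 3k(1+\log m)$, set $r\gets r+1$, $q_r\gets0$, $f_r\gets2f_{r-1}$; finally output (assign $v$ to) the center $c=\arg\min_{c\in C}\|v-c\|^2$.
   Formalization: In the first bound, log(W*/w* ) is replaced by max(1, log(W*/w* )), because the literal bound fails when W* = w* (e.g. k=1, n=2, v_1≠v_2: the bound is 0 but |C|=2); for W*/w* ≥ 2 it is the displayed bound. *)

(* Defs.v *)
From mathcomp Require Import all_boot all_order all_algebra.
From mathcomp Require Import all_classical all_reals all_analysis.

Set Implicit Arguments.
Unset Strict Implicit.
Unset Printing Implicit Defensive.

Import Order.TTheory GRing.Theory Num.Theory.

Local Open Scope classical_set_scope.
Local Open Scope ring_scope.

Section Geometry.
Variable R : realType.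

Definition log2 (x : R) : R := ln x / ln 2.

(* The canonical norm `|x| on 'rV[R]_d is the sup norm, hence this definition. *)
Definition enorm (d : nat) (x : 'rV[R]_d) : R :=
  Num.sqrt (\sum_(i < d) x 0 i ^+ 2).

(* Extremum of a nonempty list; the head is used as the neutral element, so no
   foreign value enters the minimum or maximum. *)
Definition seqmin (s : seq R) : R := \big[Num.min/head 0 s]_(x <- s) x.
Definition seqmax (s : seq R) : R := \big[Num.max/head 0 s]_(x <- s) x.

Definition pair_dists (d : nat) (s : seq 'rV[R]_d) : seq R :=
  [seq enorm (x.1 - x.2) | x <- [seq (u, w) | u <- s, w <- s] & x.1 != x.2].

Definition aspect_ratio (d : nat) (s : seq 'rV[R]_d) : R :=
  seqmax (pair_dists s) / seqmin (pair_dists s).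

Definition dist_to (d : nat) (v : 'rV[R]_d) (C : seq 'rV[R]_d) : R :=
  seqmin [seq enorm (v - c) | c <- C].

(* The partition is S_i = {j | sigma j = i}. *)
Definition kmeans_cost (k d n : nat) (v : n.-tuple 'rV[R]_d)
    (sigma : {ffun 'I_n -> 'I_k}) (c : 'I_k -> 'rV[R]_d) : R :=
  \sum_(i < k) \sum_(j < n | sigma j == i) enorm (tnth v j - c i) ^+ 2.

(* For 0 < k the infimum is attained, by the best partition and its centroids. *)
Definition opt_kmeans_cost (k d n : nat) (v : n.-tuple 'rV[R]_d) : R :=
  inf [set W | exists (sigma : {ffun 'I_n -> 'I_k}) (c : 'I_k -> 'rV[R]_d),
         W = kmeans_cost v sigma c].

End Geometry.

(* Finitely supported probability distributions, as lists of weighted outcomes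
   (an outcome may be listed several times), with their monad structure. *)
Section FiniteDistributions.
Variable R : realType.

Definition fdist (T : Type) := seq (R * T).

Definition fret (T : Type) (x : T) : fdist T := [:: (1, x)].

Definition fbind (T U : Type) (mu : fdist T) (f : T -> fdist U) : fdist U :=
  flatten [seq [seq (x.1 * y.1, y.2) | y <- f x.2] | x <- mu].

Definition fflip (p : R) : fdist bool := [:: (p, true); (1 - p, false)].

Definition fexpect (T : Type) (mu : fdist T) (g : T -> R) : R :=
  \sum_(x <- mu) x.1 * g x.2.

End FiniteDistributions.

Section OnlineKMeans.
Variables (R : realType) (k d : nat).
Local Notation V := 'rV[R]_d.

(* Distinct elements in order of first appearance ([undup] keeps the last
   occurrences instead). *)
Definition distinct (s : seq V) : seq V :=
  foldl (fun C v => if v \in C then C else rcons C v) [::] s.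

Definition init_centers (s : seq V) : seq V := take k.+1 (distinct s).

(* [rem] deletes one occurrence, the first: every other entry of the stream,
   including repetitions of an initial center, goes through the main loop. *)
Definition remaining (s : seq V) : seq V :=
  foldl (fun t c => rem c t) s (init_centers s).

Definition wstar (s : seq V) : R :=
  seqmin [seq x ^+ 2 / 2 | x <- pair_dists (init_centers s)].

(* Of the values q_1, ..., q_r and f_1, ..., f_r only q_r and f_r are ever read;
   they are stored as [hits] and [facility]. *)
Record state := State {
  centers : seq V;
  count : nat;
  hits : nat;
  facility : R
}.

Definition init_state (s : seq V) : state :=
  State (init_centers s) k.+1 0 (wstar s / k%:R).

(* The algorithm's assignment of v to a nearest center does not act on the state
   and is not modelled. *)
Definition step (v : V) (st : state) : fdist R state :=
  let m := (count st).+1 in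
  let p := Num.min (dist_to v (centers st) ^+ 2 / facility st) 1 in
  fbind (fflip p) (fun added =>
    let C := if added then undup (v :: centers st) else centers st in
    let q := if added then (hits st).+1 else hits st in
    fret R (if 3 * k%:R * (1 + log2 m%:R) <= q%:R :> R
            then State C m 0 (2 * facility st)
            else State C m q (facility st))).

Definition online_kmeans (s : seq V) : fdist R state :=
  foldl (fun mu v => fbind mu (step v)) (fret R (init_state s)) (remaining s).

Definition expected_num_centers (s : seq V) : R :=
  fexpect (online_kmeans s) (fun st => (size (centers st))%:R).

End OnlineKMeans.

(* Main.v *)
(** Fix [B = W* + w*], a clustering of cost at most [B], and [theta = B / k].
While the facility cost is below [theta] there are at most
[1 + log2 (B / w* )] phases, each adding [O(k log n)] centers.  Once it is at
least [theta], split the stream into rings, according to the nearest center of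
the clustering and to the dyadic scale [2^t B / n] of the squared distance to
it: there are [O(k log n)] rings.  The first center chosen in a ring is charged
to the ring; afterwards a point [x] of the ring is chosen with probability
[O(B / n + dist^2) / theta], and these probabilities sum to [O(k)].  Both
regimes are handled by one potential (number of centers, plus remaining budget
of the low phases, plus number of rings without a center), whose expected
increase at [x] is at most that probability bound.  Using [B] rather than [W*]
avoids having to show that the optimum is attained and positive. *)

Require Import Defs.
From mathcomp Require Import all_boot all_order all_algebra.
From mathcomp Require Import all_classical all_reals all_analysis.
From mathcomp Require Import ring lra.
Set Implicit Arguments.
Unset Strict Implicit.
Unset Printing Implicit Defensive.

Import Order.TTheory GRing.Theory Num.Theory.
Local Open Scope ring_scope.

(** * Extrema of finite lists *)

Section Extrema.
Variable R : realType.
Implicit Types (s : seq R) (x : R).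

Lemma seqmin_le s x : x \in s -> seqmin s <= x.
Proof.
rewrite /seqmin; move: (head 0 s) => x0.
elim: s => // y s IHs; rewrite big_cons inE ge_min => /predU1P[->|/IHs ->].
  by rewrite lexx.
by rewrite orbT.
Qed.

Lemma seqmax_ge s x : x \in s -> x <= seqmax s.
Proof.
rewrite /seqmax; move: (head 0 s) => x0.
elim: s => // y s IHs; rewrite big_cons inE le_max => /predU1P[->|/IHs ->].
  by rewrite lexx.
by rewrite orbT.
Qed.

Lemma seqmin_mem s : s != [::] -> seqmin s \in s.
Proof.
case: s => // y s _; rewrite /seqmin big_cons /=.
(* The neutral element [y] must stay fixed while the running minimum [z] varies in the induction;
   [z := y] gives the claim. *)
suff: forall z, Num.min z (\big[Num.min/y]_(x <- s) x) \in [:: z, y & s].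
  by move/(_ y); rewrite !inE orbA orbb.
elim: s => [|x s IHs] z;
  first by rewrite big_nil minElt; case: ifP; rewrite !inE eqxx ?orbT.
rewrite big_cons minElt; case: ifP => _; first by rewrite inE eqxx.
have := IHs x; rewrite !inE => /or3P[] ->; by rewrite ?orbT.
Qed.
End Extrema.

(** * Euclidean norm and distance to a set of centers *)

Section Enorm.
Variables (R : realType) (d : nat).
Implicit Types (x y z : 'rV[R]_d).

Lemma enorm_ge0 x : 0 <= enorm x.
Proof. exact: sqrtr_ge0. Qed.

Lemma enorm_sqrE x : enorm x ^+ 2 = \sum_(i < d) x 0 i ^+ 2.
Proof. by rewrite /enorm sqr_sqrtr// sumr_ge0// => i _; rewrite sqr_ge0. Qed.

Lemma enorm_gt0 x : x != 0 -> 0 < enorm x.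
Proof.
move=> x0; rewrite lt_def enorm_ge0 andbT; apply: contra x0 => /eqP e.
have /eqP : enorm x ^+ 2 = 0 by rewrite e expr0n.
rewrite enorm_sqrE psumr_eq0 => [/allP xi0|i _]; last exact: sqr_ge0.
apply/eqP/rowP => i; apply/eqP; rewrite mxE -sqrf_eq0.
by apply: xi0; rewrite mem_index_enum.
Qed.

(** Parallelogram identity, coordinate by coordinate: the right side minus the left is the sum of
    the squares of [x + y - 2 z]. *)
Lemma enorm_sub_sqr x y z :
  enorm (x - y) ^+ 2 <= 2 * (enorm (x - z) ^+ 2 + enorm (y - z) ^+ 2).
Proof.
rewrite !enorm_sqrE -big_split mulr_sumr; apply: ler_sum => i _ /=.
rewrite !mxE; have := sqr_ge0 (x 0 i + y 0 i - 2 * z 0 i); nra.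
Qed.

Lemma dist_to_ge0 v (C : seq 'rV[R]_d) : 0 <= dist_to v C.
Proof.
case: C => [|c C]; first by rewrite /dist_to /seqmin big_nil.
have /mapP[u _ e] : dist_to v (c :: C) \in [seq enorm (v - u) | u <- c :: C].
  exact: seqmin_mem.
by rewrite e enorm_ge0.
Qed.

Lemma dist_to_sqr_le v u (C : seq 'rV[R]_d) :
  u \in C -> dist_to v C ^+ 2 <= enorm (v - u) ^+ 2.
Proof.
move=> uC; rewrite lerXn2r ?nnegrE ?dist_to_ge0 ?enorm_ge0//.
by apply/seqmin_le/map_f.
Qed.

Lemma mem_pair_dists (s : seq 'rV[R]_d) x y :
  x \in s -> y \in s -> x != y -> enorm (x - y) \in pair_dists s.
Proof.
move=> xs ys xy; apply/mapP; exists (x, y) => //.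
by rewrite mem_filter xy; apply/allpairsP; exists (x, y).
Qed.

Lemma pair_distsP (s : seq 'rV[R]_d) r : r \in pair_dists s ->
  exists x y, [/\ x \in s, y \in s, x != y & r = enorm (x - y)].
Proof.
move=> /mapP[[x y]]; rewrite mem_filter => /andP[/= xy].
move=> /allpairsP[[x' y'] [/= xs ys [ex ey]]] ->.
by exists x, y; rewrite ex ey in xy *.
Qed.
End Enorm.

(** * Base-2 logarithm *)

Section Log2.
Variable R : realType.
Implicit Types x y : R.

Let ln2_gt0 : 0 < ln 2 :> R.
Proof. by rewrite ln_gt0// ltr1n. Qed.

Lemma log2M x y : 0 < x -> 0 < y -> log2 (x * y) = log2 x + log2 y.
Proof. by move=> x0 y0; rewrite /log2 lnM ?posrE// mulrDl. Qed.

Lemma log2_2 : log2 2 = 1 :> R.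
Proof. by rewrite /log2 divff// gt_eqF. Qed.

Lemma ler_log2 x y : 0 < x -> x <= y -> log2 x <= log2 y.
Proof.
move=> x0 xy; rewrite /log2 ler_pM2r ?invr_gt0// ler_ln ?posrE//.
exact: lt_le_trans xy.
Qed.

Lemma log2_ge0 x : 1 <= x -> 0 <= log2 x.
Proof. by move=> x1; rewrite /log2 divr_ge0 ?ln_ge0 ?ler1n. Qed.

Lemma log2_expn m : log2 (2 ^+ m) = m%:R :> R.
Proof.
elim: m => [|m IH]; first by rewrite expr0 /log2 ln1 mul0r.
by rewrite exprS log2M ?exprn_gt0// log2_2 IH -natr1 addrC.
Qed.
End Log2.

(** * Expectations over finite distributions *)

Section Expectation.
Variable R : realType.

Lemma fexpect_ret (T : Type) (x : T) (g : T -> R) : fexpect (fret R x) g = g x.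
Proof. by rewrite /fexpect /fret big_seq1 mul1r. Qed.

Lemma fexpect_flip (p : R) (g : bool -> R) :
  fexpect (fflip p) g = p * g true + (1 - p) * g false.
Proof. by rewrite /fexpect /fflip !big_cons big_nil addr0. Qed.

Lemma fexpect_bind (T U : Type) (mu : fdist R T) (f : T -> fdist R U) g :
  fexpect (fbind mu f) g = fexpect mu (fun x => fexpect (f x) g).
Proof.
rewrite /fexpect /fbind big_flatten big_map; apply: eq_bigr => x _.
by rewrite big_map mulr_sumr; apply: eq_bigr => y _; rewrite mulrA.
Qed.

Lemma eq_fexpect (T : Type) (mu : fdist R T) (g g' : T -> R) :
  g =1 g' -> fexpect mu g = fexpect mu g'.
Proof. by move=> gg'; apply: eq_bigr => x _; rewrite gg'. Qed.

(** Conditioning on the current state: a run can then be analysed from its first step on, by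
    induction over the stream with an arbitrary starting state. *)
Lemma fexpect_foldl (A T : Type) (f : A -> T -> fdist R T) mu (s : seq A) g :
  fexpect (foldl (fun mu v => fbind mu (f v)) mu s) g =
  fexpect mu (fun x => fexpect (foldl (fun mu v => fbind mu (f v)) (fret R x) s) g).
Proof.
elim: s mu => [|v s IHs] mu /=.
  by apply: eq_fexpect => x; rewrite fexpect_ret.
rewrite IHs fexpect_bind; apply: eq_fexpect => x.
by rewrite [RHS]IHs fexpect_bind fexpect_ret.
Qed.
End Expectation.

(** * Potential argument for a run, with an abstract ring map *)

Section Drift.
Variables (R : realType) (k d : nat) (K : finType).
Local Notation V := 'rV[R]_d.
(** [key] names the ring of a point, [h] will bound its probability of being added once its ring has
    a center, [N] bounds the counter, and [T] is the budget of one low phase. *)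
Variables (key : V -> K) (h : V -> R) (S : seq V) (theta T : R) (N : nat).

Definition threshold (m : nat) : R := 3 * k%:R * (1 + log2 m%:R).

Hypothesis k_gt0 : (0 < k)%N.
Hypothesis theta_gt0 : 0 < theta.
Hypothesis h_ge0 : forall v, 0 <= h v.
Hypothesis close : {in S &, forall u v,
  key u = key v -> enorm (v - u) ^+ 2 <= theta * h v}.
Hypothesis T_ge : threshold N + 1 <= T.

Lemma threshold_gt0 m : (0 < m)%N -> 0 < threshold m.
Proof.
move=> m0; rewrite /threshold !mulr_gt0 ?ltr0n// ltr_pwDl// log2_ge0//.
by rewrite ler1n.
Qed.

Lemma ler_threshold m m' : (0 < m)%N -> (m <= m')%N -> threshold m <= threshold m'.
Proof.
move=> m0 mm'; rewrite /threshold ler_wpM2l ?mulr_ge0 ?ler0n// lerD2l.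
by rewrite ler_log2 ?ltr0n ?ler_nat.
Qed.

Definition next (v : V) (st : state R d) (added : bool) : state R d :=
  let m := (Defs.count st).+1 in
  let C := if added then undup (v :: centers st) else centers st in
  let q := if added then (hits st).+1 else hits st in
  if threshold m <= q%:R then State C m 0 (2 * facility st)
  else State C m q (facility st).

Definition add_prob (v : V) (st : state R d) : R :=
  Num.min (dist_to v (centers st) ^+ 2 / facility st) 1.

Lemma fexpect_step v st g : fexpect (step k v st) g =
  add_prob v st * g (next v st true) + (1 - add_prob v st) * g (next v st false).
Proof. by rewrite /step fexpect_bind fexpect_flip !fexpect_ret. Qed.

Definition valid (st : state R d) : Prop :=
  [/\ {subset centers st <= S}, 0 < facility st, (0 < Defs.count st)%N &
      (hits st)%:R < threshold (Defs.count st)].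

Lemma count_next v st b : Defs.count (next v st b) = (Defs.count st).+1.
Proof. by rewrite /next; case: ifP. Qed.

Lemma valid_next v st b : v \in S -> valid st -> valid (next v st b).
Proof.
move=> vS [CS f0 m0 qm].
have CS' : {subset (if b then undup (v :: centers st) else centers st) <= S}.
  by case: b => // u; rewrite mem_undup inE => /predU1P[->|/CS].
rewrite /next; case: (lerP (threshold _)) => qm'; split => //=.
  by rewrite mulr_gt0.
exact: threshold_gt0.
Qed.

(** A phase cannot end without an addition: the hits were below the old threshold, and thresholds
    grow with the counter. *)
Lemma next_false v st : valid st ->
  next v st false = State (centers st) (Defs.count st).+1 (hits st) (facility st).
Proof.
move=> [_ _ m0 qm]; rewrite /next leNgt (lt_le_trans qm)//.
exact: ler_threshold.
Qed.

(* Bounds the number of centers still to be added before the facility cost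
   reaches [theta]. *)
Definition budget (f : R) (q : nat) : R :=
  if f < theta then (log2 (theta / f) + 1) * T - q%:R else 0.

(** An addition costs at least one unit of budget, whether it stays in the phase or ends it.
    Doubling [f] lowers the logarithm by 1, which releases [T], at least the [q] hits already spent
    plus one. *)
Lemma budget_hit f q : f < theta -> 0 < f -> q.+1%:R <= T ->
  budget f q.+1 + 1 <= budget f q /\ budget (2 * f) 0 + 1 <= budget f q.
Proof.
move=> ft f0 qT; rewrite /budget ft; split; first by rewrite -natr1; lra.
have T0 : 0 <= T by apply: le_trans qT; rewrite ler0n.
have e : log2 (theta / f) = log2 (theta / (2 * f)) + 1.
  rewrite -[X in _ + X](log2_2 R) -log2M ?divr_gt0 ?mulr_gt0//; congr log2.
  by field; rewrite gt_eqF.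
case: ifP => _; first by move: qT; rewrite -natr1 e; nra.
have : 0 <= log2 (theta / f) by rewrite log2_ge0// ler_pdivlMr// mul1r ltW.
by move: qT; rewrite -natr1; nra.
Qed.

Definition unhit (C : seq V) : nat := #|[pred x | x \notin map key C]|.

Lemma unhit_add v C : (unhit (undup (v :: C)) <= unhit C)%N.
Proof.
apply/subset_leq_card/fintype.subsetP => x; rewrite !inE; apply: contra.
by move=> /mapP[u uC ->]; apply: map_f; rewrite mem_undup inE uC orbT.
Qed.

Lemma unhit_add_new v C :
  key v \notin map key C -> (unhit (undup (v :: C)) < unhit C)%N.
Proof.
move=> vC; apply/proper_card/fintype.properP; split.
  apply/fintype.subsetP => x; rewrite !inE; apply: contra.
  by move=> /mapP[u uC ->]; apply: map_f; rewrite mem_undup inE uC orbT.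
exists (key v); rewrite inE// negbK; apply: map_f.
by rewrite mem_undup mem_head.
Qed.

Definition potential (st : state R d) : R :=
  (size (centers st))%:R + budget (facility st) (hits st) +
  (unhit (centers st))%:R.

Lemma potential_next_true_low v st : valid st -> facility st < theta ->
  (Defs.count st < N)%N -> potential (next v st true) <= potential st.
Proof.
move=> [_ f0 m0 qm] ft mN; set C := centers st.
(* Hits lie strictly below the threshold before the addition, hence the extra 1 in [T_ge]. *)
have qT : (hits st).+1%:R <= T.
  rewrite -natr1; apply: le_trans T_ge; rewrite lerD2r ltW//.
  by apply: lt_le_trans qm _; apply: ler_threshold => //; apply: ltnW.
have [b1 b2] := budget_hit ft f0 qT.
have sz : (size (undup (v :: C)))%:R <= (size C)%:R + 1 :> R.
  by rewrite natr1 ler_nat size_undup.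
have un : (unhit (undup (v :: C)))%:R <= (unhit C)%:R :> R.
  by rewrite ler_nat unhit_add.
by rewrite /potential /next -/C; case: ifP => _;
  cbn [centers facility hits]; rewrite -/C; lra.
Qed.

(** The budget is now 0. The new center is paid for by its ring when that ring had no center;
    otherwise it costs at most 1. *)
Lemma potential_next_true_high v st : valid st -> theta <= facility st ->
  potential (next v st true) <= potential st + (key v \in map key (centers st))%:R.
Proof.
move=> [_ f0 m0 qm] tf; set C := centers st.
have b0 q : budget (facility st) q = 0 by rewrite /budget ltNge tf.
have b1 q : budget (2 * facility st) q = 0.
  by rewrite /budget ltNge (le_trans tf)//; lra.
have sz : (size (undup (v :: C)))%:R <= (size C)%:R + 1 :> R.
  by rewrite natr1 ler_nat size_undup.
have un : (unhit (undup (v :: C)))%:R + 1 <= (unhit C)%:R + (key v \in map key C)%:R :> R.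
  rewrite natr1 -natrD ler_nat; case: (boolP (key v \in _)) => vC.
    by rewrite addn1 ltnS unhit_add.
  by rewrite addn0 unhit_add_new.
by rewrite /potential /next -/C; case: ifP => _;
  cbn [centers facility hits]; rewrite -/C ?b0 ?b1; lra.
Qed.

Lemma add_prob_ge0 v st : valid st -> 0 <= add_prob v st.
Proof. by move=> [_ f0 _ _]; rewrite le_min ler01 divr_ge0 ?sqr_ge0// ltW. Qed.

Lemma add_prob_le1 v st : add_prob v st <= 1.
Proof. by rewrite ge_min lexx orbT. Qed.

Lemma add_prob_hit v st : valid st -> theta <= facility st -> v \in S ->
  key v \in map key (centers st) -> add_prob v st <= h v.
Proof.
move=> [CS f0 _ _] tf vS /mapP[u uC uv].
rewrite ge_min ler_pdivrMr//; apply/orP; left.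
apply: le_trans (dist_to_sqr_le _ uC) _.
apply: le_trans (close (CS _ uC) vS (esym uv)) _.
by rewrite mulrC ler_wpM2l.
Qed.

(** Only an addition can change the potential. It raises it only in a high phase and in a ring that
    already has a center, by at most 1 and with probability at most [h v]. *)
Lemma potential_step v st : v \in S -> valid st -> (Defs.count st < N)%N ->
  fexpect (step k v st) potential <= potential st + h v.
Proof.
move=> vS stv mN; rewrite fexpect_step next_false//.
have -> : potential (State (centers st) (Defs.count st).+1 (hits st) (facility st)) =
          potential st by [].
have p0 := add_prob_ge0 v stv; have p1 := add_prob_le1 v st.
have hv := h_ge0 v.
have [ft|tf] := ltP (facility st) theta.
  have := potential_next_true_low v stv ft mN; nra.
have := potential_next_true_high v stv tf.
case: (boolP (key v \in _)) => vC /=; last by nra.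
have := add_prob_hit stv tf vS vC; nra.
Qed.

Lemma fexpect_run_le s st : {subset s <= S} -> valid st ->
  (Defs.count st + size s <= N)%N ->
  fexpect (foldl (fun mu v => fbind mu (step k v)) (fret R st) s)
    (fun st => (size (centers st))%:R) <=
  potential st + \sum_(v <- s) h v.
Proof.
elim: s st => [|v s IHs] st sS stv /= mN.
  (* At the end of the stream the potential dominates the number of centers, because the remaining
     budget is nonnegative. *)
  rewrite fexpect_ret big_nil addr0 /potential -addrA lerDl addr_ge0//.
  rewrite /budget; case: ifP => // ft; case: stv => _ f0 m0 qm.
  have qT : (hits st)%:R <= T.
    apply: le_trans T_ge; apply/ltW/(lt_trans qm).
    by rewrite ltr_pwDr// ler_threshold//; rewrite addn0 in mN.
  have : 0 <= log2 (theta / facility st) by rewrite log2_ge0// ler_pdivlMr// mul1r ltW.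
  have : 0 <= (hits st)%:R :> R by [].
  by nra.
have vS : v \in S by apply: sS; rewrite mem_head.
have sS' : {subset s <= S} by move=> u us; apply: sS; rewrite inE us orbT.
rewrite addnS in mN.
rewrite fexpect_foldl fexpect_bind fexpect_ret fexpect_step big_cons.
have IH b := IHs (next v st b) sS' (valid_next b vS stv).
move: (IH true) (IH false); rewrite !count_next !addSn => /(_ mN) + /(_ mN).
have mN' : (Defs.count st < N)%N by apply: leq_trans mN; rewrite ltnS leq_addr.
have := potential_step vS stv mN'; rewrite fexpect_step.
have p0 := add_prob_ge0 v stv; have p1 := add_prob_le1 v st.
(* The two induction hypotheses are averaged with weights [add_prob v st] and its complement, then
   combined with the one-step bound. *)
set E1 := fexpect _ _; set E0 := fexpect _ _.
set P1 := potential _; set P0 := potential _; set H := \sum_(_ <- _) _.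
by move=> ? ? ?; nra.
Qed.
End Drift.

(** * Initial centers, remaining stream and [wstar] *)

Section Initialization.
Variables (R : realType) (k d : nat).
Local Notation V := 'rV[R]_d.
Implicit Types s : seq V.

Lemma distinct_perm_undup s : perm_eq (distinct s) (undup s).
Proof.
(* The accumulator of the fold is generalised to any duplicate-free list. *)
suff H : forall C, uniq C ->
    let D := foldl (fun C v => if v \in C then C else rcons C v) C s in
    uniq D /\ D =i C ++ s.
  have [uD mD] := H [::] isT; apply: uniq_perm => //; first exact: undup_uniq.
  by move=> x; rewrite mD mem_undup.
elim: s => [|v s IHs] C uC /=; first by rewrite cats0.
case: ifP => vC.
  have [uD mD] := IHs C uC; split => // x; rewrite mD !mem_cat inE.
  by case: eqP => [->|//]; rewrite vC.
have [|uD mD] := IHs (rcons C v); first by rewrite rcons_uniq vC.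
by split => // x; rewrite mD cat_rcons.
Qed.

Lemma init_centers_uniq s : uniq (init_centers k s).
Proof. by rewrite take_uniq// (perm_uniq (distinct_perm_undup s)) undup_uniq. Qed.

Lemma init_centers_sub s : {subset init_centers k s <= s}.
Proof.
by move=> x /mem_take; rewrite (perm_mem (distinct_perm_undup s)) mem_undup.
Qed.

Lemma size_init_centers s :
  (k < size (undup s))%N -> size (init_centers k s) = k.+1.
Proof.
by move=> ks; rewrite size_takel// (perm_size (distinct_perm_undup s)).
Qed.

Lemma pair_dists_neq0 s : (1 < size (undup s))%N -> pair_dists s != [::].
Proof.
case e : (undup s) => [//|x [//|y t]] _.
have := undup_uniq s; rewrite e /= inE => /andP[]; rewrite negb_or => /andP[xy _] _.
have xs : x \in s by rewrite -mem_undup e mem_head.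
have ys : y \in s by rewrite -mem_undup e !inE eqxx orbT.
by have := mem_pair_dists xs ys xy; case: pair_dists.
Qed.

(** The minimum is attained, since the [k.+1] distinct initial centers, at least two, form some
    pair. *)
Lemma wstarP s : (0 < k)%N -> (k < size (undup s))%N ->
  exists x y, [/\ x \in s, y \in s, x != y & wstar k s = enorm (x - y) ^+ 2 / 2].
Proof.
move=> k0 ks; set P := pair_dists (init_centers k s).
have P0 : P != [::].
  by apply: pair_dists_neq0; rewrite (undup_id (init_centers_uniq _)) size_init_centers.
have /mapP[r rP ->] : wstar k s \in [seq x ^+ 2 / 2 | x <- P].
  by apply: seqmin_mem; rewrite -size_eq0 size_map size_eq0.
have [x [y [xs ys xy ->]]] := pair_distsP rP.
by exists x, y; split => //; apply: init_centers_sub.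
Qed.

Lemma wstar_gt0 s : (0 < k)%N -> (k < size (undup s))%N -> 0 < wstar k s.
Proof.
move=> k0 ks; have [x [y [_ _ xy ->]]] := wstarP k0 ks.
by rewrite divr_gt0 ?exprn_gt0 ?enorm_gt0// subr_eq0.
Qed.

Lemma remaining_subseq s : subseq (remaining k s) s.
Proof.
(* The list being shrunk is separated from the stream that defines the initial centers, so the
   induction is over arbitrary deletions. *)
rewrite /remaining; elim: init_centers {1 3}s => //= c C IHC t.
exact: subseq_trans (IHC _) (rem_subseq _ _).
Qed.

Lemma sum_remaining_le (h : V -> R) s : (forall v, 0 <= h v) ->
  \sum_(v <- remaining k s) h v <= \sum_(v <- s) h v.
Proof.
move=> h0; rewrite /remaining; elim: init_centers {1 3}s => //= c C IHC t.
apply: le_trans (IHC _) _; case: (boolP (c \in t)) => ct; last by rewrite rem_id.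
by rewrite [leRHS](perm_big _ (perm_to_rem ct)) big_cons lerDr.
Qed.
End Initialization.

(** * Rings around a fixed clustering of cost at most [B] *)

Section Clusters.
Variables (R : realType) (k d n : nat) (v : n.-tuple 'rV[R]_d).
Local Notation V := 'rV[R]_d.
Variables (sigma : {ffun 'I_n -> 'I_k}) (c : 'I_k -> V) (i0 : 'I_k) (B : R).
Hypotheses (n_gt0 : (0 < n)%N) (B_gt0 : 0 < B) (cost_le : kmeans_cost v sigma c <= B).

(** [sigma] acts on indices and may separate equal vectors; a nearest center depends on the vector
    alone, as a ring map requires. *)
Definition nearest (x : V) : 'I_k := [arg min_(i < i0) enorm (x - c i)]%O.
Definition sqdist (x : V) : R := enorm (x - c (nearest x)) ^+ 2.

Lemma sqdist_ge0 x : 0 <= sqdist x.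
Proof. exact: sqr_ge0. Qed.

Lemma sqdist_le x i : sqdist x <= enorm (x - c i) ^+ 2.
Proof.
rewrite /sqdist /nearest lerXn2r ?nnegrE ?enorm_ge0//.
by case: arg_minP => // j _; apply.
Qed.

Lemma sum_sqdist_le : \sum_(x <- v) sqdist x <= B.
Proof.
apply: le_trans cost_le; rewrite /kmeans_cost (exchange_big_dep xpredT)//= big_tuple.
by apply: ler_sum => j _; rewrite (big_pred1 (sigma j)) ?sqdist_le// => i; rewrite eq_sym.
Qed.

Definition scale : R := B / n%:R.
Definition depth : nat := up_log 2 n.

(* The rings have outer squared radius 2^t B/n, on a scale common to all the
   clusters. *)
Definition in_ring (x : V) (t : nat) : bool :=
  (sqdist x <= 2 ^+ t * scale) && (2 ^+ t * scale <= scale + 2 * sqdist x).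

Definition ring_key (x : V) : 'I_k * 'I_depth.+1 :=
  (nearest x, odflt ord0 [pick t : 'I_depth.+1 | in_ring x t]).

Lemma scale_gt0 : 0 < scale.
Proof. by rewrite divr_gt0// ltr0n. Qed.

Lemma in_ring_key x : x \in v -> in_ring x (ring_key x).2.
Proof.
move=> xv; rewrite /ring_key /=; case: pickP => [t //|no].
have xB : sqdist x <= B.
  apply: le_trans sum_sqdist_le; rewrite (big_rem x)//= lerDl sumr_ge0// => y _.
  exact: sqdist_ge0.
have xdepth : sqdist x <= 2 ^+ depth * scale.
  apply: le_trans xB _; rewrite /scale mulrA ler_pdivlMr ?ltr0n//.
  by rewrite mulrC ler_pM2r// -natrX ler_nat up_logP.
have ex : exists t, sqdist x <= 2 ^+ t * scale by exists depth.
case: (ex_minnP ex) => t xt tmin.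
have tM : (t < depth.+1)%N by rewrite ltnS tmin.
have := no (Ordinal tM); rewrite /in_ring /= xt /=.
case: t {tM} xt tmin => [|t] xt tmin.
  by rewrite expr0 mul1r lerDl mulr_ge0 ?sqdist_ge0.
suff -> : 2 ^+ t.+1 * scale <= scale + 2 * sqdist x by [].
have : 2 ^+ t * scale < sqdist x.
  by rewrite ltNge; apply/negP => /tmin; rewrite ltnn.
by rewrite exprS; have := scale_gt0; lra.
Qed.

(** Both points share a nearest center, and [sqdist x] is at most [scale + 2 * sqdist y] through the
    common ring radius. This yields [2 * scale + 6 * sqdist y], so the constants have slack. *)
Lemma ring_key_close x y : x \in v -> y \in v -> ring_key x = ring_key y ->
  enorm (y - x) ^+ 2 <= 4 * scale + 8 * sqdist y.
Proof.
move=> xv yv e; have /andP[x1 _] := in_ring_key xv; have /andP[y1 y2] := in_ring_key yv.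
rewrite e in x1; have /= en := congr1 fst e.
apply: le_trans (enorm_sub_sqr _ _ (c (nearest y))) _.
rewrite -/(sqdist y) -[in X in _ + X]en -/(sqdist x).
by move: (2 ^+ _ * scale) x1 y1 y2 => r; lra.
Qed.

Lemma expected_num_centers_le : (0 < k)%N -> (k < size (undup v))%N ->
  expected_num_centers k v <=
  k.+1%:R + budget (B / k%:R) (threshold R k n.*2 + 1) (wstar k v / k%:R) 0 +
  (k * depth.+1)%:R + 12 * k%:R.
Proof.
move=> k0 kv; have kR : 0 < k%:R :> R by rewrite ltr0n.
have nR : 0 < n%:R :> R by rewrite ltr0n.
have kn : (k < n)%N by apply: leq_trans kv _; rewrite -[leqRHS](size_tuple v) size_undup.
set theta := B / k%:R; have theta0 : 0 < theta by rewrite divr_gt0.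
pose h x := (4 * scale + 8 * sqdist x) / theta.
have h0 x : 0 <= h x.
  apply: divr_ge0 (ltW theta0); have := sqdist_ge0 x; have := scale_gt0; lra.
have close : {in (v : seq V) &, forall x y, ring_key x = ring_key y ->
    enorm (y - x) ^+ 2 <= theta * h y}.
  move=> x y xv yv e; rewrite /h [theta * _]mulrC (divfK (lt0r_neq0 theta0)).
  exact: ring_key_close.
have sub : {subset remaining k v <= v} by move=> x; apply/mem_subseq/remaining_subseq.
have stv : valid k v (init_state k v).
  split=> /=; [exact: init_centers_sub|by rewrite divr_gt0// wstar_gt0|by []|].
  exact: threshold_gt0.
(* The counter starts at [k.+1], at most [n], and at most [n] vectors remain. *)
have cN : (Defs.count (init_state k v) + size (remaining k v) <= n.*2)%N.
  rewrite -addnn leq_add//= -[leqRHS](size_tuple v).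
  exact/size_subseq/remaining_subseq.
apply: le_trans (fexpect_run_le k0 theta0 h0 close (lexx _) sub stv cN) _.
rewrite /potential /= size_init_centers//; apply: lerD; first apply: lerD => //.
  rewrite ler_nat; apply: leq_trans (max_card _) _.
  by rewrite card_prod !card_ord.
(* The terms [4 * scale] add up to [4 * B] and the terms [8 * sqdist] to at most [8 * B]; dividing
   by [theta = B / k] gives [12 * k]. *)
apply: le_trans (sum_remaining_le _ _ h0) _.
rewrite /h -mulr_suml ler_pdivrMr// big_split /= -[X in _ + X <= _]mulr_sumr.
rewrite [X in X + _]big_tuple sumr_const card_ord -[4 * scale *+ n]mulr_natr.
have -> : 4 * scale * n%:R = 4 * B by rewrite /scale; field; rewrite gt_eqF.
have -> : 12 * k%:R * theta = 12 * B by rewrite /theta; field; rewrite gt_eqF.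
have := sum_sqdist_le; lra.
Qed.
End Clusters.

(** * Comparison with the optimal cost and the aspect ratio *)

Section Optimum.
Variables (R : realType) (k d n : nat) (v : n.-tuple 'rV[R]_d).
Hypotheses (k_gt0 : (0 < k)%N) (kv : (k < size (undup v))%N).
Local Notation W := (opt_kmeans_cost k v).
Local Notation w := (wstar k v).

Let costs : set R := [set x | exists (sigma : {ffun 'I_n -> 'I_k})
  (c : 'I_k -> 'rV[R]_d), x = kmeans_cost v sigma c]%classic.

Let costs_lb : lbound costs 0.
Proof.
move=> _ [sigma [c ->]]; apply: sumr_ge0 => i _; apply: sumr_ge0 => j _.
exact: sqr_ge0.
Qed.

Lemma opt_kmeans_cost_le (sigma : {ffun 'I_n -> 'I_k}) (c : 'I_k -> 'rV[R]_d) :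
  W <= kmeans_cost v sigma c.
Proof. by apply: ge_inf; [exists 0; exact: costs_lb|exists sigma, c]. Qed.

Let costs_neq0 : (costs !=set0)%classic.
Proof.
by exists (kmeans_cost v [ffun=> Ordinal k_gt0] (fun=> 0)),
  [ffun=> Ordinal k_gt0], (fun=> 0).
Qed.

Lemma opt_kmeans_cost_ge0 : 0 <= W.
Proof. exact: lb_le_inf costs_neq0 costs_lb. Qed.

Lemma near_optimal eps : 0 < eps ->
  exists (sigma : {ffun 'I_n -> 'I_k}) (c : 'I_k -> 'rV[R]_d),
    kmeans_cost v sigma c <= W + eps.
Proof.
move=> e0; have [|_ [sigma [c ->]] /ltW le] := @inf_adherent R costs _ e0.
  by split; [exact: costs_neq0|exists 0; exact: costs_lb].
by exists sigma, c.
Qed.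

Lemma lt_card_stream : (k < n)%N.
Proof. by apply: leq_trans kv _; rewrite -[leqRHS](size_tuple v) size_undup. Qed.

Lemma log2_card_ge1 : 1 <= log2 (n%:R : R).
Proof.
rewrite -[leLHS](log2_2 R) ler_log2 ?ltr0n// ler_nat.
exact: leq_trans lt_card_stream.
Qed.

Lemma depth_le : (depth n)%:R <= 1 + log2 (n%:R : R).
Proof.
have n1 : (1 < n)%N by exact: leq_trans lt_card_stream.
have := up_log_gtn (isT : (1 < 2)%N) n1; rewrite -/(depth n).
case: (depth n) => [_|m /= mn]; first by have := log2_card_ge1; lra.
rewrite -natr1 addrC lerD2l -[leLHS]log2_expn ler_log2 ?exprn_gt0//.
by rewrite -natrX ler_nat ltnW.
Qed.

(** [W + w] is at most twice the larger of [W] and [w]. The maximum with 1 matters: for [k = 1] and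
    two distinct points, [W] equals [w] and the bare logarithm is 0. *)
Lemma log2_near_optimal : log2 ((W + w) / w) <= 1 + Num.max 1 (log2 (W / w)).
Proof.
have w0 := wstar_gt0 k_gt0 kv; have W0 := opt_kmeans_cost_ge0.
have [Ww|wW] := leP W w.
  apply: (@le_trans _ _ 1); last by rewrite lerDl le_max ler01.
  rewrite -[leRHS](log2_2 R) ler_log2 ?divr_gt0 ?ltr_wpDl//.
  by rewrite ler_pdivrMr//; lra.
apply: (@le_trans _ _ (1 + log2 (W / w))); last by rewrite lerD2l le_max lexx orbT.
have Wp : 0 < W := lt_trans w0 wW.
rewrite -[X in _ <= X + _](log2_2 R) -log2M ?divr_gt0//.
apply: ler_log2; first by rewrite divr_gt0// addr_gt0.
by rewrite mulrA ler_pM2r ?invr_gt0//; lra.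
Qed.

(** With [eps := w] in [near_optimal], the constant is 2 + 30 + 3 + 12: initial centers, budget,
    rings and summed probabilities, each in units of [K * l * L]. *)
Lemma expected_num_centers_opt : expected_num_centers k v <=
  47 * (k%:R * log2 n%:R * Num.max 1 (log2 (W / w))).
Proof.
have w0 := wstar_gt0 k_gt0 kv; have W0 := opt_kmeans_cost_ge0.
have B0 : 0 < W + w by rewrite ltr_wpDl.
have kn := lt_card_stream; have n0 : (0 < n)%N by exact: leq_trans kn.
have [sigma [c cB]] := near_optimal w0.
apply: le_trans (expected_num_centers_le (Ordinal k_gt0) n0 B0 cB k_gt0 kv) _.
have := log2_near_optimal; have := log2_card_ge1; have := depth_le.
set L := Num.max 1 _; have L1 : 1 <= L by rewrite le_max lexx.
have k1 : 1 <= k%:R :> R by rewrite ler1n.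
move=> Dl l1 lw; rewrite /threshold -muln2 natrM log2M ?ltr0n// log2_2 natrM.
rewrite -[k.+1%:R]natr1 -[(depth n).+1%:R]natr1.
set l := log2 n%:R in Dl l1 *; set D := (depth n)%:R in Dl *.
set K := k%:R in k1 *.
set T := 3 * K * _ + 1.
have T0 : 0 <= T by rewrite /T; nra.
have Kl : K <= K * l by nra.
(* [T] is [3 * K * (2 + l) + 1], with [K] and [l] at least 1. *)
have TKl : T <= 10 * (K * l) by rewrite /T; nra.
have bud : budget ((W + w) / K) T (w / K) 0 <= 30 * (K * l * L).
  have KlL : K * l <= K * l * L by nra.
  rewrite /budget; case: ifP => _; last by nra.
  have -> : (W + w) / K / (w / K) = (W + w) / w.
    by field; rewrite !gt_eqF//; lra.
  rewrite subr0; apply: (@le_trans _ _ ((3 * L) * T)).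
    by rewrite ler_wpM2r//; lra.
  nra.
have KlL : K * l <= K * l * L by nra.
have KD : K * (D + 1) <= 3 * (K * l) by nra.
nra.
Qed.

Lemma opt_kmeans_cost_le_diam :
  W <= n%:R * seqmax (pair_dists v) ^+ 2.
Proof.
have n0 : (0 < n)%N by exact: leq_trans lt_card_stream.
pose x0 := tnth v (Ordinal n0).
have M0 : 0 <= seqmax (pair_dists v).
  have P0 : pair_dists v != [::].
    by apply: pair_dists_neq0; apply: leq_trans kv.
  have := seqmax_ge (seqmin_mem P0); apply: le_trans.
  by have [x [y [_ _ _ ->]]] := pair_distsP (seqmin_mem P0); exact: enorm_ge0.
(* A single cluster centered at the first vector already meets the bound. *)
apply: le_trans (opt_kmeans_cost_le [ffun=> Ordinal k_gt0] (fun=> x0)) _.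
rewrite /kmeans_cost (exchange_big_dep xpredT)//=.
rewrite -[n in n%:R]card_ord -sumr_const mulr_suml.
apply: ler_sum => j _; rewrite mul1r (big_pred1 (Ordinal k_gt0)); last first.
  by move=> i /=; rewrite ffunE eq_sym.
rewrite lerXn2r ?nnegrE ?enorm_ge0//.
have [->|jx] := eqVneq (tnth v j) x0.
  by rewrite subrr /enorm big1 ?sqrtr0// => i _; rewrite mxE expr0n.
by apply: seqmax_ge; apply: mem_pair_dists; rewrite ?mem_tnth.
Qed.

(** [W] is at most [n * M ^ 2] and [w] at least [m ^ 2 / 2], for the extreme distances [M] and [m].
    As [n] is at least 2, [W / w] is at most the square of [M / m * n], whence the factor 2. *)
Lemma opt_ratio_le_aspect :
  1 <= log2 (aspect_ratio v * n%:R) /\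
  Num.max 1 (log2 (W / w)) <= 2 * log2 (aspect_ratio v * n%:R).
Proof.
have w0 := wstar_gt0 k_gt0 kv; have W0 := opt_kmeans_cost_ge0.
have P0 : pair_dists v != [::] by apply: pair_dists_neq0; apply: leq_trans kv.
have n2 : 2 <= n%:R :> R by rewrite ler_nat; exact: leq_trans lt_card_stream.
have mM := seqmax_ge (seqmin_mem P0).
have m0 : 0 < seqmin (pair_dists v).
  have [x [y [_ _ xy ->]]] := pair_distsP (seqmin_mem P0).
  by rewrite enorm_gt0// subr_eq0.
have mw : seqmin (pair_dists v) ^+ 2 / 2 <= w.
  have [x [y [xv yv xy ->]]] := wstarP k_gt0 kv.
  rewrite ler_pM2r ?invr_gt0// lerXn2r ?nnegrE ?enorm_ge0 ?(ltW m0)//.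
  exact/seqmin_le/mem_pair_dists.
have := opt_kmeans_cost_le_diam; rewrite /aspect_ratio.
move: (seqmax _) (seqmin _) mM m0 mw => M m mM m0 mw WM.
have g1 : 1 <= M / m by rewrite ler_pdivlMr// mul1r.
have gn : 2 <= M / m * n%:R by nra.
have l1 : 1 <= log2 (M / m * n%:R) by rewrite -[leLHS](log2_2 R) ler_log2.
split=> //; rewrite ge_max; apply/andP; split; first by lra.
(* If [W] were 0, its logarithm would be 0 by the convention for [ln]. *)
have [->|Wn0] := eqVneq W 0; first by rewrite mul0r {1}/log2 ln0// mul0r; lra.
have Wp : 0 < W by rewrite lt_def Wn0.
have -> : 2 * log2 (M / m * n%:R) = log2 ((M / m * n%:R) ^+ 2).
  by rewrite expr2 [RHS]log2M; lra.
apply: ler_log2; first by rewrite divr_gt0.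
rewrite ler_pdivrMr//; apply: le_trans WM _.
apply: (@le_trans _ _ ((M / m * n%:R) ^+ 2 * (m ^+ 2 / 2))); last first.
  by rewrite ler_wpM2l ?sqr_ge0.
have -> : (M / m * n%:R) ^+ 2 * (m ^+ 2 / 2) = M ^+ 2 * (n%:R ^+ 2 / 2).
  by field; rewrite gt_eqF.
by rewrite mulrC ler_wpM2l ?sqr_ge0//; nra.
Qed.
End Optimum.

Theorem theorem3 (R : realType) :
  exists c : R, forall (k d n : nat) (v : n.-tuple 'rV[R]_d),
    (0 < k)%N -> (k < size (undup v))%N ->
    let EC := expected_num_centers k v in
    let X := k%:R * log2 n%:R *
             Num.max 1 (log2 (opt_kmeans_cost k v / wstar k v)) in
    let Y := k%:R * log2 n%:R * log2 (aspect_ratio v * n%:R) in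
    [/\ EC <= c * X, X <= c * Y & EC <= c * Y].
Proof.
(* 94 is 47 * 2, from [EC <= 47 * X] and [X <= 2 * Y]. *)
exists 94 => k d n v k0 kv EC X Y.
have kl0 : 0 <= k%:R * log2 (n%:R : R).
  by rewrite mulr_ge0// (le_trans ler01)// (log2_card_ge1 k0 kv).
have ECX : EC <= 47 * X := expected_num_centers_opt k0 kv.
have [l1 XYl] := opt_ratio_le_aspect k0 kv.
have X0 : 0 <= X by rewrite mulr_ge0// le_max ler01.
have Y0 : 0 <= Y by rewrite mulr_ge0// (le_trans ler01).
have XY : X <= 2 * Y by rewrite /X /Y [leRHS]mulrCA ler_wpM2l.
by split; lra.
Qed.
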